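(* For all $p,q\in\Delta(K)$, $$\min_{u,v:\ \mathrm{marg}_Ku=p,\ \mathrm{marg}_Kv=q}d(u,v)=\sum_{k\in K}|p_k-q_k|,$$ $$\max_{u,v:\ \mathrm{marg}_Ku=p,\ \mathrm{marg}_Kv=q}d(u,v)=2\Bigl(1-\max_{p',q'\in\Delta(K)}\sum_{k\in K}\min\bigl(p_kq'_k,\;p'_kq_k\bigr)\Bigr),$$ where $u,v$ range over information structures in $\mathcal{U}$. If $p=q$, the latter is equal to $$\max_{u,v:\ \mathrm{marg}_Ku=\mathrm{marg}_Kv=p}d(u,v)=2\bigl(1-\max_{k\in K}p_k\bigr).$$
   Context: $K$ is a finite set with $|K|\ge 2$, $\mathbb{N}=\{0,1,2,\dots\}$. An information structure is an element $u$ of $\mathcal{U}=\Delta(K\times\mathbb{N}\times\mathbb{N})$; in $(k,c,d)$, $k$ is the state, $c$ the signal of player 1, $d$ the signal of player 2. $\mathrm{marg}_Ku$ is the marginal of $u$ on $K$. A payoff function is a map $g:K\times I\times J\to[-1,1]$ with $I,J$ nonempty finite sets; $\mathcal{G}$ is the set of all payoff functions. In the zero-sum Bayesian game $\Gamma(u,g)$, $(k,c,d)$ is drawn from $u$, player 1 learns $c$, player 2 learns $d$, they simultaneously choose $i\in I$ and $j\in J$, and player 1 (the maximizer) receives $g(k,i,j)$ from player 2; $\mathrm{val}(u,g)$ is its value in mixed strategies. The value-based distance is $d(u,v)=\sup_{g\in\mathcal{G}}|\mathrm{val}(u,g)-\mathrm{val}(v,g)|$. *)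

(* Defs.v *)
From HB Require Import structures.
From mathcomp Require Import all_boot all_order all_algebra.
From mathcomp Require Import all_classical all_reals all_analysis.

Set Implicit Arguments.
Unset Strict Implicit.
Unset Printing Implicit Defensive.

Import Order.TTheory GRing.Theory Num.Theory.
Import numFieldNormedType.Exports.

Local Open Scope classical_set_scope.
Local Open Scope ring_scope.

Definition is_dist (R : realType) (T : finType) (p : T -> R) : Prop :=
  (forall t, 0 <= p t) /\ \sum_t p t = 1.

Definition is_max (R : realType) (A : set R) (m : R) : Prop :=
  A m /\ ubound A m.

Definition is_min (R : realType) (A : set R) (m : R) : Prop :=
  A m /\ lbound A m.

(* Sum over all pairs of signals, as the limit of the sums over the squares
   {0, ..., n-1}^2.  It is only applied to absolutely summable families, for
   which it does not depend on the order of summation. *)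
Definition sum_signals (R : realType) (f : nat -> nat -> R) : R :=
  limn (fun n => \sum_(c < n) \sum_(d < n) f c d).

(* An element of Delta(K x N x N), given by its probability mass function. *)
Record info_structure (R : realType) (K : finType) := InfoStructure {
  info_mass :> K -> nat -> nat -> R;
  info_mass_ge0 : forall k c d, 0 <= info_mass k c d;
  info_mass_sum1 :
    (fun n => \sum_k \sum_(c < n) \sum_(d < n) info_mass k c d) @ \oo --> (1 : R)
}.

Definition margK (R : realType) (K : finType) (u : info_structure R K) (k : K) : R :=
  sum_signals (u k).

Definition is_payoff (R : realType) (K I J : finType) (g : K -> I -> J -> R) : Prop :=
  forall k i j, -1 <= g k i j <= 1.

(* A mixed strategy maps each received signal to a distribution over actions. *)
Definition strategy (R : realType) (A : finType) : set (nat -> A -> R) :=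
  [set s | forall c, is_dist (s c)].

Definition expected_payoff (R : realType) (K I J : finType)
    (u : info_structure R K) (g : K -> I -> J -> R)
    (s : nat -> I -> R) (t : nat -> J -> R) : R :=
  \sum_k sum_signals (fun c d =>
    u k c d * \sum_i \sum_j s c i * t d j * g k i j).

Definition maxmin (R : realType) (K I J : finType)
    (u : info_structure R K) (g : K -> I -> J -> R) : R :=
  sup [set inf [set expected_payoff u g s t | t in @strategy R J]
      | s in @strategy R I].

Definition minmax (R : realType) (K I J : finType)
    (u : info_structure R K) (g : K -> I -> J -> R) : R :=
  inf [set sup [set expected_payoff u g s t | s in @strategy R I]
      | t in @strategy R J].

Definition is_value (R : realType) (K I J : finType)
    (u : info_structure R K) (g : K -> I -> J -> R) (x : R) : Prop :=
  maxmin u g = x /\ minmax u g = x.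

(* The unique x with [is_value u g x].  Such an x exists by the minimax theorem
   when I and J are nonempty; the default 0 is immaterial. *)
Definition val_game (R : realType) (K I J : finType)
    (u : info_structure R K) (g : K -> I -> J -> R) : R :=
  xget 0 (is_value u g).

Definition value_distance (R : realType) (K : finType)
    (u v : info_structure R K) : R :=
  sup [set r | exists (I J : finType) (g : K -> I -> J -> R),
    [/\ (0 < #|I|)%N, (0 < #|J|)%N, is_payoff g
      & r = `|val_game u g - val_game v g|]].

Definition distances (R : realType) (K : finType) (p q : K -> R) : set R :=
  [set r | exists u v : info_structure R K,
    [/\ margK u =1 p, margK v =1 q & r = value_distance u v]].

Definition overlaps (R : realType) (K : finType) (p q : K -> R) : set R :=
  [set r | exists p' q' : K -> R, [/\ is_dist p', is_dist q'
    & r = \sum_k Num.min (p k * q' k) (p' k * q k)]].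

(* Main.v *)
Require Import Defs.
From HB Require Import structures.
From mathcomp Require Import all_boot all_order all_algebra.
From mathcomp Require Import all_classical all_reals all_analysis.
From mathcomp Require Import ring lra.

Set Implicit Arguments.
Unset Strict Implicit.
Unset Printing Implicit Defensive.

Import Order.TTheory GRing.Theory Num.Theory.
Import numFieldNormedType.Exports.

Local Open Scope classical_set_scope.
Local Open Scope ring_scope.

(** A Bayesian game between structures [u] and [v] is compared through replies:
    if against every strategy [s] of player 1 in [u] and every strategy [t] of
    player 2 in [v] there are a reply [t'] in [u] and a reply [s'] in [v] with
    payoff_u(s, t') <= payoff_v(s', t) + e, then val(u) <= val(v) + e
    ([val_game_le_of_replies]).  This rests on the existence of the value, which
    holds despite the countably many signals: up to an arbitrarily small payoff
    only finitely many signals matter ([truncated_payoff_error]), and the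
    truncated game is a finite matrix game ([minimax], [maxmin_eq_minmax]).

    Minimum.  When the payoff is the sign of p_k - q_k and no action matters,
    the values are the expectations of that sign, so the distance is always at
    least sum_k |p_k - q_k|; if nobody gets any information this bound cannot
    be exceeded, because the same strategies can be used under both priors.

    Maximum, upper bound.  Let p' and q' be arbitrary distributions.  Against
    [s] in [u], player 2 ignores the signal, draws a state l from q' and plays
    as [t] does on average in [v] given l; against [t] in [v], player 1 draws k
    from p' and imitates the average of [s] in [u] given k.  With sigma_k and
    tau_l the two average behaviours, the payoffs are the sums of
    p_k q'_l g(k, sigma_k, tau_l) and of p'_k q_l g(l, sigma_k, tau_l).  On the
    diagonal k = l the same number g(k, sigma_k, tau_k) occurs in both, so the
    difference loses 2 min(p_k q'_k, p'_k q_k) there and is at most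
    2 (1 - sum_k min(p_k q'_k, p'_k q_k)) ([val_game_le_overlap]).

    Maximum, attainment.  A matrix game in which one player picks two states and
    the other a set of states has the maximal overlap M as its value; an optimal
    mixed set gives weights alpha_k in [0, 1] and numbers with a + b = M,
    alpha_k p_k <= a and (1 - alpha_k) q_k <= b ([overlap_duality]).  Let player
    1 alone know the state in [u] and player 2 alone know it in [v], and let
    both players try to name it.  A player who alone names it wins 1; when both
    do, player 1 gets 1 - 2 alpha_k.  Truthful play secures 1 - 2a for player 1
    in [u] and -1 + 2b for player 2 in [v], so the distance is at least
    2 (1 - M) ([guessing_game_distance]).  For p = q the maximal overlap is the
    largest p_k, reached when p' and q' sit on the same likeliest state. *)

(** * Finite distributions *)

Section FiniteDistributions.
Variable R : realType.

Definition dirac_at (T : finType) (a t : T) : R := (t == a)%:R.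

Lemma sum_dirac_at (T : finType) (a : T) (f : T -> R) :
  \sum_t dirac_at a t * f t = f a.
Proof.
rewrite (bigD1 a) //= /dirac_at eqxx mul1r big1 ?addr0 // => t /negPf ->.
by rewrite mul0r.
Qed.

Lemma dirac_at_dist (T : finType) (a : T) : is_dist (dirac_at a).
Proof.
split=> [t|]; first exact: ler0n.
by under eq_bigr do rewrite -[dirac_at a _]mulr1; rewrite sum_dirac_at.
Qed.

Lemma dist_le1 (T : finType) (x : T -> R) t : is_dist x -> x t <= 1.
Proof.
by case=> x0 <-; rewrite (bigD1 t) //= lerDl sumr_ge0.
Qed.

End FiniteDistributions.

(** * The minimax theorem for matrix games *)

Section FiniteMinimax.
Variables (R : realType).

(** First-order condition at the end point of a segment: a quadratic that does
    not go below its value at 0 starts with a nonnegative slope. *)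
Lemma slope_ge0 (s d : R) : 0 <= d ->
  (forall e, 0 < e <= 1 -> 0 <= e * s + e ^+ 2 * d) -> 0 <= s.
Proof.
move=> d0 H; rewrite leNgt; apply/negP => s0.
pose e := - s / (d + 1 - s).
have den : 0 < d + 1 - s by lra.
have e01 : 0 < e <= 1 by rewrite divr_gt0 ?oppr_gt0 // ler_pdivrMr //; lra.
have /andP[e0 _] := e01.
have := H e e01; rewrite expr2 -mulrA -mulrDr pmulr_rge0 // => {}H.
have ed : e * d < - s.
  by rewrite mulrAC ltr_pdivrMr //; nra.
lra.
Qed.

Section Compactness.
Import ArrowAsProduct.
Variables (I J : finType) (A : I -> J -> R).

(** A point [z] of [I + J -> R] carries a mixed strategy of each player; the gap
    at [(i, j)] is the payoff of the row [i] minus the payoff of the column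
    [j] against them.  Both strategies are optimal exactly when no gap is
    positive. *)
Definition gap (z : I + J -> R) i j : R :=
  \sum_j' A i j' * z (inr j') - \sum_i' A i' j * z (inl i').

Lemma continuous_sum (T : topologicalType) (S : finType) (f : S -> T -> R) :
  (forall s, continuous (f s)) -> continuous (fun x => \sum_s f s x).
Proof.
move=> cf; apply: (@continuous_big R S +%R 0) => //.
exact: add_continuous.
Qed.

Lemma gap_continuous i j : continuous (fun z : I + J -> R => gap z i j).
Proof.
have cproj t : continuous (fun z : I + J -> R => z t).
  exact: (@proj_continuous _ (fun _ : I + J => R) t).
move=> z; apply: (@continuousB _ R^o); apply: continuous_sum => t {}z;
  by apply: continuousM; [exact: cst_continuous|exact: cproj].
Qed.

(** The pairs of distributions form a closed subset of a cube, which is compact,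
    and the objective is continuous. *)
Lemma gap_square_min (i0 : I) (j0 : J) :
  exists z : I + J -> R,
  [/\ is_dist (z \o inl), is_dist (z \o inr)
    & forall z', is_dist (z' \o inl) -> is_dist (z' \o inr) ->
       \sum_i \sum_j Num.max 0 (gap z i j) ^+ 2
       <= \sum_i \sum_j Num.max 0 (gap z' i j) ^+ 2].
Proof.
pose D := [set z : I + J -> R | is_dist (z \o inl) /\ is_dist (z \o inr)].
pose C := [set z : I + J -> R | forall t, `[0, 1]%classic (z t)].
have cproj t : continuous (fun z : I + J -> R => z t).
  exact: (@proj_continuous _ (fun _ : I + J => R) t).
have Ccompact : compact C.
  exact: (@tychonoff (I + J)%type (fun _ => R) (fun _ => `[0, 1]%classic)
    (fun _ => @segment_compact R 0 1)).
have DC : D `<=` C.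
  move=> z [zI zJ] [i|j] /=; rewrite in_itv /=.
    by rewrite (proj1 zI i) (dist_le1 i zI).
  by rewrite (proj1 zJ j) (dist_le1 j zJ).
have Dclosed : closed D.
  have -> : D = [set z | forall t, [set r | 0 <= r] (z t)] `&`
      ((fun z => \sum_i z (inl i)) @^-1` [set r | r = 1] `&`
      (fun z => \sum_j z (inr j)) @^-1` [set r | r = 1]).
    apply/seteqP; split=> z /=.
      move=> [[zI sI] [zJ sJ]]; split=> //.
      by case=> t; [exact: zI|exact: zJ].
    move=> [z0 [sI sJ]]; split; split=> // t; exact: z0.
  apply: closedI.
    rewrite (_ : [set z | _] =
      \bigcap_t ((fun z : I + J -> R => z t) @^-1` [set r | 0 <= r])).
      apply: closed_bigI => t _; apply: preimage_closed (@closed_ge R 0) => z _.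
      exact: cproj.
    by apply/seteqP; split=> z /= H t; [move=> _|]; exact: H.
  apply: closedI; apply: preimage_closed (@closed_eq R 1) => z _;
    apply: continuous_sum => t; exact: cproj.
have Dcompact := subclosed_compact Dclosed Ccompact DC.
have D0 : D !=set0.
  pose z t : R := match t with inl i => dirac_at R i0 i | inr j => dirac_at R j0 j end.
  exists z; split; exact: dirac_at_dist.
pose F z := \sum_i \sum_j Num.max 0 (gap z i j) ^+ 2.
have Fcont : continuous F.
  apply: continuous_sum => i; apply: continuous_sum => j z.
  have cm : {for z, continuous (fun z : I + J -> R => Num.max 0 (gap z i j))}.
    apply: continuous_max; first exact: cst_continuous.
    exact: gap_continuous.
  exact: (continuousM cm cm).
have [z Dz zmin] := compact_EVT_min D0 Dcompact (continuous_subspaceT Fcont).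
move: Dz; rewrite inE => -[zI zJ]; exists z; split=> // z' zI' zJ'.
by apply: zmin; rewrite inE.
Qed.

End Compactness.

(** At a minimiser of the sum of the squared positive gaps, let [w i j] be the
    positive part of the gap.  Moving towards the pure pair [(i', j')] cannot
    decrease the sum, which bounds [b i' + c] by [a j'], where [a] and [b] are the
    payoffs against the marginals [nu] and [mu] of [w], and [c] is the sum of the
    squares of the [w i j].  Averaging this inequality with [nu] and [mu]
    themselves makes both sides the payoff of [nu] against [mu], so [c] must
    vanish and every gap is nonpositive. *)
Theorem minimax (I J : finType) (A : I -> J -> R) :
  (0 < #|I|)%N -> (0 < #|J|)%N ->
  exists (V : R) (x : I -> R) (y : J -> R),
  [/\ is_dist x, is_dist y,
      forall j, V <= \sum_i x i * A i j & forall i, \sum_j y j * A i j <= V].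
Proof.
move=> /card_gt0P[i0 _] /card_gt0P[j0 _].
have [z [zI zJ zmin]] := gap_square_min A i0 j0.
pose r := gap A z; pose w i j := Num.max 0 (r i j).
have w0 i j : 0 <= w i j by rewrite le_max lexx.
suff gap_le0 : forall i j, r i j <= 0.
  pose Ay i := \sum_j z (inr j) * A i j.
  have Ayx i j : Ay i <= \sum_i' z (inl i') * A i' j.
    have := gap_le0 i j; rewrite /r /gap subr_le0 /Ay.
    by under eq_bigr do rewrite mulrC; under [X in _ <= X]eq_bigr do rewrite mulrC.
  have [i1 _ i1max] := @arg_maxP _ _ _ i0 predT Ay isT.
  exists (Ay i1), (z \o inl), (z \o inr); split=> // i.
  exact: i1max.
pose c := \sum_i \sum_j w i j * r i j.
have wr i j : w i j * r i j = w i j ^+ 2.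
  by rewrite /w; case: (leP 0 (r i j)) => _; rewrite ?mul0r ?expr2 ?mul0r.
pose nu i := \sum_j w i j; pose mu j := \sum_i w i j.
pose a j := \sum_i nu i * A i j; pose b i := \sum_j mu j * A i j.
(* the first-order condition in the direction of the pure pair (i', j') *)
have key i' j' : b i' + c <= a j'.
  pose d i j := A i j' - A i' j - r i j.
  suff : 0 <= 2 * \sum_i \sum_j w i j * d i j.
    rewrite pmulr_rge0 // => H; rewrite -subr_ge0.
    apply: le_trans H _; rewrite le_eqVlt; apply/orP; left; apply/eqP.
    rewrite opprD addrA /a /b /c /nu /mu.
    have -> : \sum_i0 (\sum_j w i0 j) * A i0 j' = \sum_i \sum_j w i j * A i j'.
      by apply: eq_bigr => i _; rewrite mulr_suml.
    have -> : \sum_j (\sum_i w i j) * A i' j = \sum_i \sum_j w i j * A i' j.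
      by rewrite exchange_big; apply: eq_bigr => j _; rewrite mulr_suml.
    rewrite -!sumrB; apply: eq_bigr => i _; rewrite -!sumrB.
    by apply: eq_bigr => j _; rewrite /d; ring.
  apply: (@slope_ge0 _ (\sum_i \sum_j d i j ^+ 2)).
    by apply: sumr_ge0 => i _; apply: sumr_ge0 => j _; exact: sqr_ge0.
  move=> e /andP[e0 e1].
  pose z' (t : I + J) := match t with
    | inl i => z (inl i) + e * (dirac_at R i' i - z (inl i))
    | inr j => z (inr j) + e * (dirac_at R j' j - z (inr j)) end.
  have mixdist (T : finType) (x : T -> R) t0 : is_dist x ->
      is_dist (fun t => x t + e * (dirac_at R t0 t - x t)).
    move=> [x0 x1]; have [h0 h1] := dirac_at_dist R t0; split=> [t|].
      have := x0 t; have := h0 t; nra.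
    by rewrite big_split /= -mulr_sumr sumrB h1 x1 subrr mulr0 addr0.
  have gapz' i j : gap A z' i j = r i j + e * d i j.
    rewrite /d /r /gap /z'.
    have lin (T : finType) (x f : T -> R) t0 :
      \sum_t f t * (x t + e * (dirac_at R t0 t - x t)) =
      \sum_t f t * x t + e * (f t0 - \sum_t f t * x t).
      rewrite -(sum_dirac_at t0 f) -sumrB mulr_sumr -big_split /=.
      by apply: eq_bigr => t _; ring.
    by rewrite !lin; ring.
  have := zmin z' (mixdist _ (z \o inl) i' zI) (mixdist _ (z \o inr) j' zJ).
  rewrite -subr_ge0 => /le_trans; apply.
  rewrite !mulr_sumr -big_split -sumrB /=; apply: ler_sum => i _.
  rewrite !mulr_sumr -big_split -sumrB /=; apply: ler_sum => j _.
  (* max 0 (r + e d) is 0 or lies between 0 and w + e d, since r <= w *)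
  rewrite gapz' -/(r i j) -/(w i j).
  have rw : r i j <= w i j by rewrite le_max lexx orbT.
  have := w0 i j; case: (leP 0 (r i j + e * d i j)) => H W.
    nra.
  have := sqr_ge0 (w i j + e * d i j); nra.
pose L := \sum_i nu i.
have Lmu : L = \sum_j mu j by rewrite /L /nu /mu exchange_big.
have nu0 i : 0 <= nu i by apply: sumr_ge0.
have mu0 j : 0 <= mu j by apply: sumr_ge0.
have same : \sum_i nu i * b i = \sum_j mu j * a j.
  rewrite /a /b; under eq_bigr do rewrite mulr_sumr.
  rewrite exchange_big; apply: eq_bigr => j _; rewrite mulr_sumr.
  by apply: eq_bigr => i _; ring.
set W := \sum_i nu i * b i in same.
have step1 j : W + L * c <= L * a j.
  rewrite /W /L !mulr_suml -big_split /=; apply: ler_sum => i _.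
  by rewrite -mulrDr; exact: ler_wpM2l.
have step2 : L * (W + L * c) <= L * W.
  rewrite {1}Lmu [X in _ <= _ * X]same [leLHS]mulr_suml [leRHS]mulr_sumr.
  apply: ler_sum => j _.
  by rewrite [leRHS]mulrCA; exact: ler_wpM2l.
have cw : c = \sum_i \sum_j w i j ^+ 2.
  by apply: eq_bigr => i _; apply: eq_bigr => j _; exact: wr.
move=> i j; rewrite leNgt; apply/negP => rij.
have wij : 0 < w i j by rewrite /w lt_max rij orbT.
have c0 : 0 < c.
  rewrite cw (bigD1 i) //= (bigD1 j) //= -addrA ltr_pwDl ?exprn_gt0 //.
  apply: addr_ge0; first by apply: sumr_ge0 => ? _; exact: sqr_ge0.
  by apply: sumr_ge0 => ? _; apply: sumr_ge0 => ? _; exact: sqr_ge0.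
have L0 : 0 < L.
  rewrite /L /nu (bigD1 i) //= (bigD1 j) //= -addrA ltr_pwDl //.
  apply: addr_ge0; first by apply: sumr_ge0.
  by apply: sumr_ge0 => ? _; apply: sumr_ge0.
have := mulr_gt0 L0 (mulr_gt0 L0 c0).
lra.
Qed.

End FiniteMinimax.

(** * Sums over pairs of signals *)

Section SquareSums.
Variable R : realType.

Definition square_sum (f : nat -> nat -> R) (n : nat) : R :=
  \sum_(c < n) \sum_(d < n) f c d.

Lemma square_sum_nondecreasing f : (forall c d, 0 <= f c d) ->
  nondecreasing_seq (square_sum f).
Proof.
move=> f0; apply/nondecreasing_seqP => n.
rewrite /square_sum [leRHS]big_ord_recr /= -[leLHS]addr0 lerD ?sumr_ge0 //.
by apply: ler_sum => c _; rewrite big_ord_recr lerDl.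
Qed.

Lemma square_sumB f g n :
  square_sum (fun c d => f c d - g c d) n = square_sum f n - square_sum g n.
Proof.
rewrite /square_sum -sumrB; apply: eq_bigr => c _.
by rewrite -sumrB.
Qed.

Lemma square_sum_lincomb (T : finType) (a : T -> R) (f : T -> nat -> nat -> R) n :
  square_sum (fun c d => \sum_t a t * f t c d) n =
  \sum_t a t * square_sum (f t) n.
Proof.
rewrite /square_sum; under eq_bigr do rewrite exchange_big /=.
rewrite exchange_big; apply: eq_bigr => t _; rewrite mulr_sumr.
by apply: eq_bigr => c _; rewrite mulr_sumr.
Qed.

Lemma sum_signalsE f l : square_sum f @ \oo --> l -> sum_signals f = l.
Proof. by move/cvg_lim; apply; exact: norm_hausdorff. Qed.

Lemma cvg_fsum (S : finType) (f : S -> nat -> R) (l : S -> R) :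
  (forall s, f s @ \oo --> l s) ->
  (fun n => \sum_s f s n) @ \oo --> \sum_s l s.
Proof.
move=> fl; apply: (@cvg_big R S +%R 0 predT) => //.
exact: add_continuous.
Qed.

End SquareSums.

Section WeightedSums.
Variables (R : realType) (K : finType) (u : info_structure R K).

Definition mass (n : nat) : R := \sum_k square_sum (u k) n.

Lemma mass_cvg : mass @ \oo --> (1 : R).
Proof. exact: info_mass_sum1. Qed.

Lemma mass_le1 n : mass n <= 1.
Proof.
have -> : 1 = limn mass by rewrite (cvg_lim _ mass_cvg).
apply: nondecreasing_cvgn_le; last by apply: cvgP; exact: mass_cvg.
move=> m m' mm'; apply: ler_sum => k _.
exact: (square_sum_nondecreasing (@info_mass_ge0 _ _ u k)).
Qed.

(** Monotone convergence: the partial sums are bounded by twice the total mass. *)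
Lemma cvg_square_sum_nonneg k f :
  (forall c d, 0 <= f c d) -> (forall c d, f c d <= 2 * u k c d) ->
  square_sum f @ \oo --> sum_signals f.
Proof.
move=> f0 fu; apply: (@nondecreasing_is_cvgn R (square_sum f)).
  exact: square_sum_nondecreasing.
exists 2 => _ [n _ <-]; apply: (@le_trans _ _ (2 * square_sum (u k) n)).
  rewrite /square_sum mulr_sumr; apply: ler_sum => c _.
  by rewrite mulr_sumr; apply: ler_sum => d _.
rewrite -[leRHS]mulr1 ler_pM2l //; apply: le_trans (mass_le1 n).
rewrite /mass (bigD1 k) //= lerDl; apply: sumr_ge0 => l _.
by apply: sumr_ge0 => c _; apply: sumr_ge0 => d _; exact: info_mass_ge0.
Qed.

Lemma cvg_marg k : square_sum (u k) @ \oo --> margK u k.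
Proof.
apply: (@cvg_square_sum_nonneg k) => c d; first exact: info_mass_ge0.
by have := @info_mass_ge0 _ _ u k c d; lra.
Qed.

(** Adding [u k] makes the summand nonnegative, which reduces this to the
    monotone case. *)
Lemma cvg_weighted k w : (forall c d, `|w c d| <= 1) ->
  square_sum (fun c d => u k c d * w c d) @ \oo -->
  sum_signals (fun c d => u k c d * w c d).
Proof.
move=> w1; pose f c d := u k c d * w c d + u k c d.
have fl : square_sum f @ \oo --> sum_signals f.
  apply: (@cvg_square_sum_nonneg k) => c d; have := w1 c d;
  by rewrite ler_norml /f => /andP[]; have := @info_mass_ge0 _ _ u k c d; nra.
have fuE : square_sum (fun c d => u k c d * w c d) =
    (fun n => square_sum f n - square_sum (u k) n).
  apply/funext => n; rewrite -square_sumB; congr square_sum.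
  by apply/funext => c; apply/funext => d; rewrite /f addrK.
have H : square_sum (fun c d => u k c d * w c d) @ \oo -->
    sum_signals f - margK u k.
  by rewrite fuE; apply: cvgB; [exact: fl|exact: cvg_marg].
by rewrite (sum_signalsE H).
Qed.

(** The tails of the two nonnegative families [u k * (1 - w)] and
    [u k * (1 + w)] are nonnegative. *)
Lemma weighted_tail k w n : (forall c d, `|w c d| <= 1) ->
  `|sum_signals (fun c d => u k c d * w c d)
    - square_sum (fun c d => u k c d * w c d) n|
  <= margK u k - square_sum (u k) n.
Proof.
move=> w1.
suff tail v : (forall c d, `|v c d| <= 1) ->
    sum_signals (fun c d => u k c d * v c d)
    - square_sum (fun c d => u k c d * v c d) n
    <= margK u k - square_sum (u k) n.
  rewrite ler_norml tail // andbT lerNl opprB.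
  have neg m : square_sum (fun c d => u k c d * - w c d) m =
      - square_sum (fun c d => u k c d * w c d) m.
    rewrite /square_sum -sumrN; apply: eq_bigr => c _; rewrite -sumrN.
    by apply: eq_bigr => d _; rewrite mulrN.
  have nw1 c d : `|- w c d| <= 1 by rewrite normrN.
  have := tail _ nw1; rewrite neg opprK addrC.
  rewrite (@sum_signalsE _ _ (- sum_signals (fun c d => u k c d * w c d))) //.
  rewrite (_ : square_sum _ = - square_sum (fun c d => u k c d * w c d)).
    by apply: cvgN; exact: cvg_weighted.
  exact/funext/neg.
move=> v1; pose f c d := u k c d - u k c d * v c d.
have fl : square_sum f @ \oo --> margK u k - sum_signals (fun c d => u k c d * v c d).
  rewrite (_ : square_sum f = fun m => square_sum (u k) m -
      square_sum (fun c d => u k c d * v c d) m).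
    by apply: cvgB; [exact: cvg_marg|exact: cvg_weighted].
  by apply/funext => m; rewrite -square_sumB.
have f_nd : nondecreasing_seq (square_sum f).
  apply: square_sum_nondecreasing => c d; have := v1 c d.
  by rewrite ler_norml /f => /andP[]; have := @info_mass_ge0 _ _ u k c d; nra.
have := nondecreasing_cvgn_le f_nd (cvgP _ fl) n.
have -> : limn (square_sum f) = margK u k - sum_signals (fun c d => u k c d * v c d).
  exact: sum_signalsE fl.
by rewrite square_sumB; lra.
Qed.

Lemma sum_margK : \sum_k margK u k = 1.
Proof.
have := cvg_fsum cvg_marg; have := mass_cvg.
move=> /cvg_lim <-; last exact: norm_hausdorff.
by move=> /cvg_lim <-; last exact: norm_hausdorff.
Qed.

Lemma margK_ge0 k : 0 <= margK u k.
Proof.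
have := @weighted_tail k (fun _ _ => 0) 0%N.
rewrite /square_sum !big_ord0 !subr0 => H.
by apply: le_trans (normr_ge0 _) (H _) => c d; rewrite normr0.
Qed.

Lemma sum_signals_lincomb k (T : finType) (a : T -> R) (w : T -> nat -> nat -> R) :
  (forall t c d, `|w t c d| <= 1) ->
  sum_signals (fun c d => u k c d * \sum_t a t * w t c d) =
  \sum_t a t * sum_signals (fun c d => u k c d * w t c d).
Proof.
move=> w1; apply: sum_signalsE.
rewrite (_ : square_sum _ = fun n =>
    \sum_t a t * square_sum (fun c d => u k c d * w t c d) n).
  apply: cvg_fsum => t; apply: cvgMr; exact: cvg_weighted.
apply/funext => n; rewrite -square_sum_lincomb; congr (square_sum _ n).
apply/funext => c; apply/funext => d; rewrite mulr_sumr.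
by apply: eq_bigr => t _; rewrite mulrCA.
Qed.

End WeightedSums.

(** * Payoffs, maxmin and minmax *)

Section GameValue.
Variables (R : realType) (K I J : finType).
Variables (g : K -> I -> J -> R).
Hypotheses (hI : (0 < #|I|)%N) (hJ : (0 < #|J|)%N) (hg : is_payoff g).

Definition stage_payoff k (x : I -> R) (y : J -> R) : R :=
  \sum_i \sum_j x i * y j * g k i j.

Lemma stage_payoff_norm k x y : is_dist x -> is_dist y ->
  `|stage_payoff k x y| <= 1.
Proof.
move=> [x0 x1] [y0 y1]; apply: le_trans (ler_norm_sum _ _ _) _.
rewrite -x1; apply: ler_sum => i _; apply: le_trans (ler_norm_sum _ _ _) _.
rewrite -[leRHS]mulr1 -y1 mulr_sumr; apply: ler_sum => j _.
rewrite normrM ger0_norm ?mulr_ge0 // -[leRHS]mulr1 ler_wpM2l ?mulr_ge0 //.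
by rewrite ler_norml; exact: hg.
Qed.

Definition truncated_payoff (u : info_structure R K) n
    (s : nat -> I -> R) (t : nat -> J -> R) : R :=
  \sum_k square_sum (fun c d => u k c d * stage_payoff k (s c) (t d)) n.

Lemma truncated_payoff_error u n s t : strategy s -> strategy t ->
  `|expected_payoff u g s t - truncated_payoff u n s t| <= 1 - mass u n.
Proof.
move=> hs ht; rewrite -(sum_margK u) /mass /truncated_payoff -!sumrB.
apply: le_trans (ler_norm_sum _ _ _) _; apply: ler_sum => k _.
apply: (@weighted_tail _ _ u k (fun c d => stage_payoff k (s c) (t d))) => c d.
exact: stage_payoff_norm.
Qed.

Lemma expected_payoff_bound u s t : strategy s -> strategy t ->
  -1 <= expected_payoff u g s t <= 1.
Proof.
move=> hs ht; rewrite -ler_norml; have := truncated_payoff_error u 0 hs ht.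
rewrite /truncated_payoff /mass /square_sum.
by do 2!(rewrite big1; last by move=> k _; rewrite big_ord0); rewrite !subr0.
Qed.

Lemma strategy_nonempty (T : finType) : (0 < #|T|)%N -> (@strategy R T) !=set0.
Proof.
by move=> /card_gt0P[a _]; exists (fun _ => dirac_at R a) => c; exact: dirac_at_dist.
Qed.

Lemma maxmin_ge u s a : strategy s ->
  (forall t, strategy t -> a <= expected_payoff u g s t) -> a <= maxmin u g.
Proof.
move=> hs H; have [t0 ht0] := strategy_nonempty hJ.
apply: (@le_trans _ _ (inf [set expected_payoff u g s t | t in @strategy R J])).
  apply: lb_le_inf; first by exists (expected_payoff u g s t0), t0.
  by move=> _ [t ht <-]; exact: H.
apply: ub_le_sup; last by exists s.
exists 1 => _ [s' hs' <-].
have /andP[_ /(le_trans _)] := expected_payoff_bound u hs' ht0; apply.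
apply: ge_inf; last by exists t0.
by exists (-1) => _ [t ht <-]; have /andP[] := expected_payoff_bound u hs' ht.
Qed.

Lemma minmax_le u t b : strategy t ->
  (forall s, strategy s -> expected_payoff u g s t <= b) -> minmax u g <= b.
Proof.
move=> ht H; have [s0 hs0] := strategy_nonempty hI.
apply: (@le_trans _ _ (sup [set expected_payoff u g s t | s in @strategy R I])).
  apply: ge_inf; last by exists t.
  exists (-1) => _ [t' ht' <-].
  have /andP[/le_trans H' _] := expected_payoff_bound u hs0 ht'; apply: H'.
  apply: ub_le_sup; last by exists s0.
  by exists 1 => _ [s hs <-]; have /andP[] := expected_payoff_bound u hs ht'.
apply: ge_sup; first by exists (expected_payoff u g s0 t), s0.
by move=> _ [s hs <-]; exact: H.
Qed.

(** Any reply [t'] in [u] bounds the guarantee of [s] from above, and any reply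
    [s'] in [v] bounds the cost of [t] from below.  The strategies of the
    two games are unrelated, so structures with different signals can be
    compared. *)
Lemma maxmin_le_of_replies u v e :
  (forall s t, strategy s -> strategy t -> exists s' t',
    [/\ strategy s', strategy t'
      & expected_payoff u g s t' <= expected_payoff v g s' t + e]) ->
  maxmin u g <= minmax v g + e.
Proof.
move=> H; have [s0 hs0] := strategy_nonempty hI.
have [t0 ht0] := strategy_nonempty hJ.
apply: ge_sup; first by eexists; exists s0.
move=> _ [s hs <-]; rewrite -lerBlDr; apply: lb_le_inf.
  by eexists; exists t0.
move=> _ [t ht <-]; rewrite lerBlDr.
have [s' [t' [hs' ht' st]]] := H s t hs ht.
apply: (@le_trans _ _ (expected_payoff u g s t')).
  apply: ge_inf; last by exists t'.
  by exists (-1) => _ [t1 ht1 <-]; have /andP[] := expected_payoff_bound u hs ht1.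
apply: le_trans st _; rewrite lerD2r; apply: ub_le_sup; last by exists s'.
by exists 1 => _ [s1 hs1 <-]; have /andP[] := expected_payoff_bound v hs1 ht.
Qed.

End GameValue.

(** * Existence of the value *)

Section Truncation.
Variable R : realType.

(** A pure strategy prescribes actions for the first [n.+1] signals only; [inord]
    sends every larger signal to 0, which yields a strategy on all signals
    without a case distinction. *)
Definition pure (T : finType) n (f : {ffun 'I_n.+1 -> T}) (c : nat) : T -> R :=
  dirac_at R (f (inord c)).

(** The behaviour strategy induced by a mixture of pure ones.  Correlations
    between the actions at different signals are forgotten; they do not affect
    the payoff because a player only receives one signal. *)
Definition mix (T : finType) n (x : {ffun 'I_n.+1 -> T} -> R) (c : nat) (a : T) : R :=
  \sum_f x f * pure f c a.

Lemma mix_strategy (T : finType) n (x : {ffun 'I_n.+1 -> T} -> R) :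
  is_dist x -> strategy (mix x).
Proof.
move=> [x0 x1] c; split=> [a|]; first by apply: sumr_ge0 => f _; rewrite mulr_ge0 ?ler0n.
rewrite exchange_big -x1; apply: eq_bigr => f _.
by rewrite -mulr_sumr (proj2 (dirac_at_dist _ _)) mulr1.
Qed.

Definition linear_payoff (T : finType) n (B : 'I_n -> T -> R) (s : nat -> T -> R) : R :=
  \sum_(c < n) \sum_a s c a * B c a.

Lemma linear_payoff_mix (T : finType) n (B : 'I_n.+1 -> T -> R)
    (x : {ffun 'I_n.+1 -> T} -> R) :
  linear_payoff B (mix x) = \sum_f x f * linear_payoff B (pure f).
Proof.
rewrite /linear_payoff; under [RHS]eq_bigr do rewrite mulr_sumr.
rewrite [RHS]exchange_big; apply: eq_bigr => c _.
under [RHS]eq_bigr do rewrite mulr_sumr.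
rewrite [RHS]exchange_big; apply: eq_bigr => a _.
by rewrite /mix mulr_suml; apply: eq_bigr => f _; rewrite mulrA.
Qed.

Lemma pure_best_reply (T : finType) n (B : 'I_n.+1 -> T -> R) s :
  (0 < #|T|)%N -> strategy s ->
  exists f : {ffun 'I_n.+1 -> T}, linear_payoff B s <= linear_payoff B (pure f).
Proof.
move=> /card_gt0P[a0 _] hs.
pose f : {ffun 'I_n.+1 -> T} := [ffun c => [arg max_(a > a0) B c a]%O].
exists f; apply: ler_sum => c _; rewrite /pure sum_dirac_at inord_val.
have [s0 s1] := hs c; rewrite -[leRHS]mul1r -s1 mulr_suml.
apply: ler_sum => a _; apply: ler_wpM2l => //.
by rewrite ffunE; case: arg_maxP => // b _; exact.
Qed.

Variables (K I J : finType) (g : K -> I -> J -> R) (u : info_structure R K).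

Lemma truncated_payoff_linearl n t : exists B : 'I_n -> I -> R,
  forall s, truncated_payoff g u n s t = linear_payoff B s.
Proof.
exists (fun c i => \sum_k \sum_(d < n) \sum_j u k c d * t d j * g k i j) => s.
rewrite /truncated_payoff /square_sum /linear_payoff exchange_big.
apply: eq_bigr => c _.
under [RHS]eq_bigr do rewrite mulr_sumr.
rewrite [RHS]exchange_big; apply: eq_bigr => k _.
under [RHS]eq_bigr do rewrite mulr_sumr.
rewrite [RHS]exchange_big; apply: eq_bigr => d _; rewrite mulr_sumr.
apply: eq_bigr => i _; rewrite !mulr_sumr; apply: eq_bigr => j _; ring.
Qed.

Lemma truncated_payoff_linearr n s : exists B : 'I_n -> J -> R,
  forall t, truncated_payoff g u n s t = linear_payoff B t.
Proof.
exists (fun d j => \sum_k \sum_(c < n) \sum_i u k c d * s c i * g k i j) => t.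
rewrite /truncated_payoff /square_sum /linear_payoff.
under eq_bigr do rewrite exchange_big; rewrite exchange_big.
apply: eq_bigr => d _.
under [RHS]eq_bigr do rewrite mulr_sumr.
rewrite [RHS]exchange_big; apply: eq_bigr => k _.
under [RHS]eq_bigr do rewrite mulr_sumr.
rewrite [RHS]exchange_big; apply: eq_bigr => c _.
rewrite /stage_payoff exchange_big mulr_sumr.
apply: eq_bigr => j _; rewrite !mulr_sumr; apply: eq_bigr => i _; ring.
Qed.

Hypotheses (hI : (0 < #|I|)%N) (hJ : (0 < #|J|)%N) (hg : is_payoff g).

(** The matrix game on pure strategies gives optimal mixtures, and playing them
    signal by signal is optimal: the payoff is linear in each player's behaviour
    separately, so a best reply can be taken pure. *)
Lemma truncated_minimax n : exists (V : R) s t,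
  [/\ strategy s, strategy t,
    forall t', strategy t' -> V <= truncated_payoff g u n.+1 s t' &
    forall s', strategy s' -> truncated_payoff g u n.+1 s' t <= V].
Proof.
have card_ffun (T : finType) : (0 < #|T|)%N -> (0 < #|{ffun 'I_n.+1 -> T}|)%N.
  by move=> /card_gt0P[a _]; apply/card_gt0P; exists [ffun _ => a].
have [V [x [y [hx hy Vx Vy]]]] := @minimax R _ _
  (fun f h => truncated_payoff g u n.+1 (pure f) (pure h))
  (card_ffun I hI) (card_ffun J hJ).
exists V, (mix x), (mix y); split; [exact: mix_strategy|exact: mix_strategy| |].
- move=> t ht; have [B2 E2] := truncated_payoff_linearr n.+1 (mix x).
  (* player 2 minimises, hence the opposite of the linear form *)
  have [h hh] := pure_best_reply (fun d j => - B2 d j) hJ ht.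
  apply: (@le_trans _ _ (truncated_payoff g u n.+1 (mix x) (pure h))).
    have [B1 E1] := truncated_payoff_linearl n.+1 (pure h).
    rewrite E1 linear_payoff_mix; apply: le_trans (Vx h) _.
    by under eq_bigr do rewrite E1.
  rewrite !E2 -lerN2 /linear_payoff -!sumrN; move: hh; rewrite /linear_payoff.
  under eq_bigr do under eq_bigr do rewrite mulrN.
  under [leRHS]eq_bigr do under eq_bigr do rewrite mulrN.
  under eq_bigr do rewrite sumrN.
  by under [leRHS]eq_bigr do rewrite sumrN.
- move=> s hs; have [B1 E1] := truncated_payoff_linearl n.+1 (mix y).
  have [f hf] := pure_best_reply B1 hI hs.
  apply: (@le_trans _ _ (truncated_payoff g u n.+1 (pure f) (mix y))).
    by rewrite !E1.
  have [B2 E2] := truncated_payoff_linearr n.+1 (pure f).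
  rewrite E2 linear_payoff_mix; apply: le_trans (Vy f).
  by under [leRHS]eq_bigr do rewrite E2.
Qed.

(** If the signals outside the truncation have mass at most e / 2, optimal
    strategies of the truncated game guarantee its value V up to e / 2 on both
    sides. *)
Lemma maxmin_eq_minmax : maxmin u g = minmax u g.
Proof.
apply/eqP; rewrite eq_le; apply/andP; split.
  rewrite -[leRHS]addr0; apply: maxmin_le_of_replies => // s t hs ht.
  by exists s, t; rewrite addr0.
apply/ler_addgt0Pr => e e0.
have [n _ /(_ n.+1 (leqnSn n))] : \forall n \near \oo, 1 - e / 2 < mass u n.
  apply: (cvgr_gt (1 : R)); first exact: mass_cvg.
  by rewrite ltrBlDr ltrDl divr_gt0.
move=> /= mn.
have [V [s [t [hs ht Vs Vt]]]] := truncated_minimax n.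
have lo : V - e / 2 <= maxmin u g.
  apply: (maxmin_ge hJ hg hs) => t' ht'.
  have := truncated_payoff_error hg u n.+1 hs ht'; rewrite ler_norml => /andP[H _].
  have := Vs t' ht'; lra.
have hi : minmax u g <= V + e / 2.
  apply: (minmax_le hI hg ht) => s' hs'.
  have := truncated_payoff_error hg u n.+1 hs' ht; rewrite ler_norml => /andP[_ H].
  have := Vt s' hs'; lra.
lra.
Qed.

Lemma val_gameP : maxmin u g = val_game u g /\ minmax u g = val_game u g.
Proof.
apply: (@xgetPex _ 0 (is_value u g)); exists (maxmin u g); split=> //.
by rewrite maxmin_eq_minmax.
Qed.

Lemma val_game_ge s a : strategy s ->
  (forall t, strategy t -> a <= expected_payoff u g s t) -> a <= val_game u g.
Proof. by rewrite -(proj1 val_gameP); exact: maxmin_ge. Qed.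

Lemma val_game_le t b : strategy t ->
  (forall s, strategy s -> expected_payoff u g s t <= b) -> val_game u g <= b.
Proof. by rewrite -(proj2 val_gameP); exact: minmax_le. Qed.

End Truncation.

Lemma val_game_le_of_replies (R : realType) (K I J : finType)
    (g : K -> I -> J -> R) (u v : info_structure R K) e :
  (0 < #|I|)%N -> (0 < #|J|)%N -> is_payoff g ->
  (forall s t, strategy s -> strategy t -> exists s' t',
    [/\ strategy s', strategy t'
      & expected_payoff u g s t' <= expected_payoff v g s' t + e]) ->
  val_game u g <= val_game v g + e.
Proof.
move=> hI hJ hg H; rewrite -(proj1 (val_gameP u hI hJ hg)).
by rewrite -(proj2 (val_gameP v hI hJ hg)); exact: maxmin_le_of_replies.
Qed.

(** * The value-based distance *)

Lemma ler_distlD (R : realDomainType) (a b B : R) :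
  (`|a - b| <= B) = (a <= b + B) && (b <= a + B).
Proof. by rewrite ler_distl lerBlDr andbC. Qed.

Section ValueDistance.
Variables (R : realType) (K : finType) (u v : info_structure R K).

Lemma value_distance_le B :
  (forall (I J : finType) (g : K -> I -> J -> R),
    (0 < #|I|)%N -> (0 < #|J|)%N -> is_payoff g ->
    val_game u g <= val_game v g + B /\ val_game v g <= val_game u g + B) ->
  value_distance u v <= B.
Proof.
move=> H; apply: ge_sup.
  have g0 : is_payoff (fun (_ : K) (_ _ : unit) => 0 : R).
    by move=> *; rewrite lerN10 ler01.
  by eexists; exists unit, unit, (fun _ _ _ => 0); rewrite card_unit; split=> //.
move=> _ [I [J [g [hI hJ hg ->]]]]; have [uv vu] := H I J g hI hJ hg.
by move: (val_game u g) (val_game v g) uv vu => a b; rewrite ler_distlD => -> ->.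
Qed.

(** The supremum is over a bounded set because all values lie in [-1, 1]. *)
Lemma value_distance_ge (I J : finType) (g : K -> I -> J -> R) a :
  (0 < #|I|)%N -> (0 < #|J|)%N -> is_payoff g ->
  a <= val_game u g - val_game v g -> a <= value_distance u v.
Proof.
move=> hI hJ hg /le_trans; apply; apply: le_trans (ler_norm _) _.
apply: ub_le_sup; last by exists I, J, g.
exists 2 => _ [{hI hJ hg g}I' [J' [g [hI hJ hg ->]]]].
have [s0 hs0] := strategy_nonempty R hI; have [t0 ht0] := strategy_nonempty R hJ.
have bound w : -1 <= val_game w g <= 1.
  apply/andP; split.
    apply: (@val_game_ge _ _ _ _ _ _ hI hJ hg s0) => // t ht.
    by have /andP[] := expected_payoff_bound hg w hs0 ht.
  apply: (@val_game_le _ _ _ _ _ _ hI hJ hg t0) => // s hs.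
  by have /andP[] := expected_payoff_bound hg w hs ht0.
have := bound u; have := bound v.
move: (val_game u g) (val_game v g) => a' b'; rewrite ler_norml; lra.
Qed.

End ValueDistance.

(** * Structures with deterministic signals *)

Section PointStructure.
Variables (R : realType) (K : finType).

Lemma square_sum_point (f : nat -> nat -> R) a b n : (a < n)%N -> (b < n)%N ->
  (forall c d, (c, d) != (a, b) -> f c d = 0) -> square_sum f n = f a b.
Proof.
move=> an bn f0; rewrite /square_sum (bigD1 (Ordinal an)) //= (bigD1 (Ordinal bn)) //=.
rewrite !big1 ?addr0 // => [c ca|d db].
  by apply: big1 => d _; apply: f0; apply: contra_neq ca => -[ca _]; exact/val_inj.
by apply: f0; apply: contra_neq db => -[db]; exact/val_inj.
Qed.

Lemma cvg_square_sum_point (f : nat -> nat -> R) a b :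
  (forall c d, (c, d) != (a, b) -> f c d = 0) -> square_sum f @ \oo --> f a b.
Proof.
move=> f0; apply: cvg_near_cst; exists (maxn a b).+1 => // n /=.
by rewrite gtn_max => /andP[an bn]; exact: square_sum_point.
Qed.

Definition point_mass (p : K -> R) (gamma delta : K -> nat) k c d : R :=
  p k * ((c, d) == (gamma k, delta k))%:R.

Lemma cvg_point_mass p gamma delta k :
  square_sum (point_mass p gamma delta k) @ \oo --> p k.
Proof.
have -> : p k = point_mass p gamma delta k (gamma k) (delta k).
  by rewrite /point_mass eqxx mulr1.
apply: cvg_square_sum_point => c d /negPf cd.
by rewrite /point_mass cd mulr0.
Qed.

Variables (p : K -> R) (hp : is_dist p) (gamma delta : K -> nat).

Lemma point_mass_ge0 k c d : 0 <= point_mass p gamma delta k c d.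
Proof. by rewrite mulr_ge0 ?ler0n //; case: hp. Qed.

Lemma point_mass_sum1 :
  (fun n => \sum_k \sum_(c < n) \sum_(d < n) point_mass p gamma delta k c d)
    @ \oo --> (1 : R).
Proof. by rewrite -(proj2 hp); apply: cvg_fsum => k; exact: cvg_point_mass. Qed.

Definition point_structure : info_structure R K :=
  InfoStructure point_mass_ge0 point_mass_sum1.

Lemma margK_point_structure : margK point_structure =1 p.
Proof. by move=> k; apply: sum_signalsE; exact: cvg_point_mass. Qed.

Lemma expected_payoff_point_structure (I J : finType) (g : K -> I -> J -> R) s t :
  expected_payoff point_structure g s t =
  \sum_k p k * stage_payoff g k (s (gamma k)) (t (delta k)).
Proof.
apply: eq_bigr => k _; apply: sum_signalsE.
rewrite [X in _ --> X](_ : _ = point_mass p gamma delta k (gamma k) (delta k) *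
    stage_payoff g k (s (gamma k)) (t (delta k))); last first.
  by rewrite /point_mass eqxx mulr1.
apply: (@cvg_square_sum_point (fun c d => point_mass p gamma delta k c d *
  stage_payoff g k (s c) (t d))) => c d /negPf cd.
by rewrite /point_mass cd mulr0 mul0r.
Qed.

End PointStructure.

(** * The upper bound by the overlap *)

Section UpperBound.
Variables (R : realType) (K : finType).

(** [sigma k] is the conditional law given the state [k] of an action drawn from
    [X c d]; on a state of probability zero any law will do. *)
Lemma conditional_law (u : info_structure R K) (T : finType)
    (X : nat -> nat -> T -> R) : (0 < #|T|)%N -> (forall c d, is_dist (X c d)) ->
  exists sigma : K -> T -> R, (forall k, is_dist (sigma k)) /\
    forall k a, sum_signals (fun c d => u k c d * X c d a) = margK u k * sigma k a.
Proof.
move=> /card_gt0P[a0 _] hX.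
have X1 a c d : `|X c d a| <= 1.
  by rewrite ger0_norm ?(dist_le1 a (hX c d)) //; case: (hX c d).
pose S k a := sum_signals (fun c d => u k c d * X c d a).
have S0 k a : 0 <= S k a.
  apply: limr_ge; first by apply: cvgP; exact: (@cvg_weighted _ _ u k _ (X1 a)).
  apply: nearW => n; apply: sumr_ge0 => c _; apply: sumr_ge0 => d _.
  by rewrite mulr_ge0 ?info_mass_ge0 //; case: (hX c d).
have Ssum k : \sum_a S k a = margK u k.
  have := @sum_signals_lincomb _ _ u k T (fun _ => 1) (fun a c d => X c d a) X1.
  under [RHS]eq_bigr do rewrite mul1r; move=> <-; congr sum_signals.
  apply/funext => c; apply/funext => d; under eq_bigr do rewrite mul1r.
  by rewrite (proj2 (hX c d)) mulr1.
exists (fun k a => if margK u k == 0 then dirac_at R a0 a else S k a / margK u k).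
split=> k; have [m0|m0] := eqVneq (margK u k) 0.
- exact: dirac_at_dist.
- split=> [a|]; first by rewrite divr_ge0 ?margK_ge0.
  by rewrite -mulr_suml Ssum divff.
- move=> a; rewrite m0 mul0r; apply/eqP; rewrite eq_le S0 andbT -m0 -Ssum.
  by rewrite (bigD1 a) //= lerDl sumr_ge0.
- by move=> a; rewrite mulrC divfK.
Qed.

Variables (I J : finType) (g : K -> I -> J -> R).
Hypotheses (hI : (0 < #|I|)%N) (hJ : (0 < #|J|)%N) (hg : is_payoff g).

Lemma stage_payoffEl k x y :
  stage_payoff g k x y = \sum_i (\sum_j y j * g k i j) * x i.
Proof.
apply: eq_bigr => i _; rewrite mulr_suml; apply: eq_bigr => j _; ring.
Qed.

Lemma stage_payoffEr k x y :
  stage_payoff g k x y = \sum_j (\sum_i x i * g k i j) * y j.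
Proof.
rewrite /stage_payoff exchange_big.
apply: eq_bigr => i _; rewrite mulr_suml; apply: eq_bigr => j _; ring.
Qed.

(** Against an opponent who ignores the signal, only the conditional law of the
    actions given the state matters. *)
Lemma uninformative_payoffr (u : info_structure R K) s : strategy s ->
  exists sigma, (forall k, is_dist (sigma k)) /\
    forall y, expected_payoff u g s (fun _ => y) =
      \sum_k margK u k * stage_payoff g k (sigma k) y.
Proof.
move=> hs; have [sigma [hsigma E]] := conditional_law u hI (fun c _ => hs c).
exists sigma; split=> // y; apply: eq_bigr => k _.
transitivity (sum_signals (fun c d => u k c d *
    \sum_i (\sum_j y j * g k i j) * s c i)).
  congr sum_signals; apply/funext => c; apply/funext => d.
  by rewrite -stage_payoffEl.
rewrite (@sum_signals_lincomb _ _ u k I _ (fun i c _ => s c i)); last first.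
  move=> i c _; rewrite ger0_norm ?(dist_le1 i (hs c)) //; by case: (hs c).
rewrite stage_payoffEl mulr_sumr; apply: eq_bigr => i _; rewrite E; ring.
Qed.

Lemma uninformative_payoffl (u : info_structure R K) t : strategy t ->
  exists tau, (forall k, is_dist (tau k)) /\
    forall x, expected_payoff u g (fun _ => x) t =
      \sum_k margK u k * stage_payoff g k x (tau k).
Proof.
move=> ht; have [tau [htau E]] := conditional_law u hJ (fun _ d => ht d).
exists tau; split=> // x; apply: eq_bigr => k _.
transitivity (sum_signals (fun c d => u k c d *
    \sum_j (\sum_i x i * g k i j) * t d j)).
  congr sum_signals; apply/funext => c; apply/funext => d.
  by rewrite -stage_payoffEr.
rewrite (@sum_signals_lincomb _ _ u k J _ (fun j _ d => t d j)); last first.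
  move=> j _ d; rewrite ger0_norm ?(dist_le1 j (ht d)) //; by case: (ht d).
rewrite stage_payoffEr mulr_sumr; apply: eq_bigr => j _; rewrite E; ring.
Qed.

Lemma average_dist (T : finType) (r : K -> R) (x : K -> T -> R) :
  is_dist r -> (forall k, is_dist (x k)) -> is_dist (fun a => \sum_k r k * x k a).
Proof.
move=> [r0 r1] hx; split=> [a|].
  by apply: sumr_ge0 => k _; rewrite mulr_ge0 //; case: (hx k).
rewrite exchange_big -r1; apply: eq_bigr => k _.
by rewrite -mulr_sumr (proj2 (hx k)) mulr1.
Qed.

Lemma stage_payoff_averagel (r : K -> R) (x : K -> I -> R) k y :
  stage_payoff g k (fun i => \sum_l r l * x l i) y =
  \sum_l r l * stage_payoff g k (x l) y.
Proof.
rewrite stage_payoffEl; under eq_bigr do rewrite mulr_sumr.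
rewrite exchange_big; apply: eq_bigr => l _; rewrite stage_payoffEl mulr_sumr.
apply: eq_bigr => i _; ring.
Qed.

Lemma stage_payoff_averager (r : K -> R) (y : K -> J -> R) k x :
  stage_payoff g k x (fun j => \sum_l r l * y l j) =
  \sum_l r l * stage_payoff g k x (y l).
Proof.
rewrite stage_payoffEr; under eq_bigr do rewrite mulr_sumr.
rewrite exchange_big; apply: eq_bigr => l _; rewrite stage_payoffEr mulr_sumr.
apply: eq_bigr => j _; ring.
Qed.

(** Each player replies by imitating the average behaviour of the counterpart in
    the other game, given a state drawn from [q'] or [p'].  The payoffs of both
    games become double sums over the same numbers [h m k l]. *)
Lemma val_game_le_overlap (u v : info_structure R K) (p q p' q' : K -> R) :
  is_dist p -> is_dist q -> is_dist p' -> is_dist q' ->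
  margK u =1 p -> margK v =1 q ->
  val_game u g <=
    val_game v g + 2 * (1 - \sum_k Num.min (p k * q' k) (p' k * q k)).
Proof.
move=> hp hq hp' hq' up vq; apply: val_game_le_of_replies => // s t hs ht.
have [sigma [hsigma sigmaE]] := uninformative_payoffr u hs.
have [tau [htau tauE]] := uninformative_payoffl v ht.
exists (fun _ i => \sum_k p' k * sigma k i), (fun _ j => \sum_l q' l * tau l j).
split=> [c|c|]; [exact: average_dist|exact: average_dist|].
rewrite sigmaE tauE -lerBlDl.
pose h m k l := stage_payoff g m (sigma k) (tau l).
have h1 m k l : `|h m k l| <= 1 by exact: stage_payoff_norm.
have -> : \sum_k margK u k * stage_payoff g k (sigma k) (fun j => \sum_l q' l * tau l j)
    = \sum_k \sum_l p k * q' l * h k k l.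
  apply: eq_bigr => k _; rewrite stage_payoff_averager up mulr_sumr.
  by apply: eq_bigr => l _; rewrite mulrA.
have -> : \sum_k margK v k * stage_payoff g k (fun i => \sum_l p' l * sigma l i) (tau k)
    = \sum_k \sum_l p' k * q l * h l k l.
  rewrite exchange_big; apply: eq_bigr => l _.
  rewrite stage_payoff_averagel vq mulr_sumr.
  by apply: eq_bigr => k _; rewrite mulrA [q l * _]mulrC.
rewrite -sumrB.
have -> : 2 * (1 - \sum_k Num.min (p k * q' k) (p' k * q k)) =
    \sum_k \sum_l (p k * q' l + p' k * q l -
      dirac_at R k l * (2 * Num.min (p l * q' l) (p' l * q l))).
  transitivity (\sum_k (p k + p' k - 2 * Num.min (p k * q' k) (p' k * q k))).
    rewrite sumrB big_split /= (proj2 hp) (proj2 hp') -mulr_sumr; ring.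
  apply: eq_bigr => k _; rewrite sumrB big_split /= sum_dirac_at -!mulr_sumr.
  by rewrite (proj2 hq) (proj2 hq') !mulr1.
apply: ler_sum => k _; rewrite -sumrB; apply: ler_sum => l _.
(* On the diagonal both terms have the factor z = h k k k of absolute value at
   most 1, and (A - B) z <= |A - B| = A + B - 2 min A B. *)
have a0 : 0 <= p k * q' l by rewrite mulr_ge0 //; [case: hp|case: hq'].
have b0 : 0 <= p' k * q l by rewrite mulr_ge0 //; [case: hp'|case: hq].
have := h1 k k l; have := h1 l k l; rewrite !ler_norml /dirac_at.
move: a0 b0.
have [->|_] := eqVneq l k.
  rewrite mul1r; move: (p k * q' k) (p' k * q k) (h k k k) => A B z.
  move=> _ _ _ /andP[z0 z1]; case: (leP A B) => AB.
    have : 0 <= (B - A) * (1 + z) by apply: mulr_ge0; lra.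
    lra.
  have : 0 <= (A - B) * (1 - z) by apply: mulr_ge0; lra.
  lra.
rewrite mul0r subr0.
move: (p k * q' l) (p' k * q l) (h k k l) (h l k l) => A B z z'; nra.
Qed.

End UpperBound.

(** * Duality for the maximal overlap *)

Section OverlapDuality.
Variables (R : realType) (K : finType) (p q : K -> R).

(** Since min(x, y) is the minimum of alpha x + (1 - alpha) y over alpha in
    [0, 1], the maximal overlap is the value of the zero-sum game where one player
    chooses [k] and [l] (with mixed laws [p'] and [q']) and the other a set
    [S] of states, [alpha k] being the probability that [S] contains [k].
    Splitting the optimality of [alpha] over [l] and [k] gives [a] and [b]. *)
Lemma overlap_duality : (0 < #|K|)%N -> exists (a b : R) (alpha : K -> R),
  [/\ forall k, 0 <= alpha k <= 1, forall k, alpha k * p k <= a,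
      forall k, (1 - alpha k) * q k <= b & is_max (overlaps p q) (a + b)].
Proof.
move=> K0.
pose A (kl : K * K) (S : {set K}) : R :=
  (kl.2 \in S)%:R * p kl.2 + (kl.1 \notin S)%:R * q kl.1.
have KK0 : (0 < #|{: K * K}|)%N by rewrite card_prod muln_gt0 K0.
have sets0 : (0 < #|{set K}|)%N by apply/card_gt0P; exists finset.set0.
have [V [x [y [[x0 x1] [y0 y1] Vx Vy]]]] := minimax A KK0 sets0.
pose p' k := \sum_l x (k, l); pose q' l := \sum_k x (k, l).
have x1' : \sum_k \sum_l x (k, l) = 1 by rewrite pair_bigA -x1; apply: eq_bigr => -[].
have hp' : is_dist p' by split=> [k|//]; exact: sumr_ge0.
have hq' : is_dist q'.
  by split=> [l|]; [exact: sumr_ge0|rewrite /q' exchange_big].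
pose alpha k := \sum_(S : {set K}) y S * (k \in S)%:R.
have alpha0 k : 0 <= alpha k by apply: sumr_ge0 => S _; rewrite mulr_ge0.
have alphaC k : 1 - alpha k = \sum_(S : {set K}) y S * (k \notin S)%:R.
  rewrite -[X in X - _]y1 -sumrB; apply: eq_bigr => S _; rewrite -{1}[y S]mulr1 -mulrBr.
  by case: (k \in S); rewrite /= ?mulr0n ?mulr1n ?subrr ?subr0.
have alpha1 k : alpha k <= 1.
  by rewrite -subr_ge0 alphaC; apply: sumr_ge0 => S _; rewrite mulr_ge0.
have alphaV k l : alpha l * p l + (1 - alpha k) * q k <= V.
  apply: le_trans (Vy (k, l)); rewrite alphaC !mulr_suml -big_split /=.
  by apply: ler_sum => S _; rewrite /A mulrDr !mulrA.
have [k0 _] := card_gt0P K0.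
have [l1 _ l1max] := @arg_maxP _ _ _ k0 predT (fun k => alpha k * p k) isT.
exists (alpha l1 * p l1), (V - alpha l1 * p l1), alpha; split.
- by move=> k; rewrite alpha0 alpha1.
- by move=> k; exact: l1max.
- by move=> k; rewrite lerBrDl.
have upper r : overlaps p q r -> r <= V.
  move=> [p1 [q1 [[p10 p11] [q10 q11] ->]]].
  have bound : \sum_k (alpha k * (p k * q1 k) + (1 - alpha k) * (p1 k * q k)) <= V.
    rewrite -[leRHS](subrK (alpha l1 * p l1)) addrC big_split lerD //.
      rewrite -[leRHS]mulr1 -q11 mulr_sumr; apply: ler_sum => k _.
      by rewrite mulrA ler_wpM2r //; exact: l1max.
    rewrite -[leRHS]mulr1 -[X in _ <= _ * X]p11 mulr_sumr; apply: ler_sum => k _.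
    by rewrite mulrCA [leRHS]mulrC ler_wpM2l // lerBrDl.
  apply: le_trans bound; apply: ler_sum => k _.
  have := alpha0 k; have := alpha1 k.
  move: (alpha k) (p k * q1 k) (p1 k * q k) => a c d a1 a0.
  by case: (leP c d) => cd; nra.
rewrite addrC subrK; split=> [|r]; last exact: upper.
have attained : overlaps p q (\sum_k Num.min (p k * q' k) (p' k * q k)).
  by exists p', q'.
suff -> : V = \sum_k Num.min (p k * q' k) (p' k * q k) by [].
apply/eqP; rewrite eq_le upper // andbT.
(* the best reply to p' and q' picks the smaller term at each state *)
pose S := [set k | p k * q' k <= p' k * q k]%SET.
apply: le_trans (Vx S) _; rewrite le_eqVlt; apply/orP; left; apply/eqP.
transitivity (\sum_k \sum_l x (k, l) * A (k, l) S).
  by rewrite pair_bigA; apply: eq_bigr => -[].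
transitivity (\sum_k ((k \in S)%:R * (p k * q' k) + (k \notin S)%:R * (p' k * q k))).
  rewrite big_split /=.
  have -> : \sum_k (k \in S)%:R * (p k * q' k) =
      \sum_k \sum_l x (k, l) * ((l \in S)%:R * p l).
    rewrite exchange_big; apply: eq_bigr => l _; rewrite /q' !mulr_sumr.
    apply: eq_bigr => k _; ring.
  rewrite -big_split; apply: eq_bigr => k _.
  rewrite /p' mulr_suml mulr_sumr -big_split; apply: eq_bigr => l _ /=.
  rewrite /A /=; ring.
apply: eq_bigr => k _; rewrite inE.
by case: leP; rewrite ?mul1r ?mul0r ?addr0 ?add0r.
Qed.

End OverlapDuality.

(** * Extremal structures and games *)

Section ExtremeStructures.
Variables (R : realType) (K : finType).

Definition code (k : K) : nat := enum_rank k.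

(** The strategy that decodes the signal and names the state; the default [k0] is
    only used for signals that code no state. *)
Definition reveal (k0 : K) (c : nat) : K -> R := dirac_at R (nth k0 (enum K) c).

Lemma reveal_strategy k0 : strategy (reveal k0).
Proof. by move=> c; exact: dirac_at_dist. Qed.

Lemma reveal_code k0 k : reveal k0 (code k) = dirac_at R k.
Proof. by rewrite /reveal /code nth_enum_rank. Qed.

Definition informed1 (p : K -> R) (hp : is_dist p) :=
  point_structure hp code (fun _ => 0%N).
Definition informed2 (p : K -> R) (hp : is_dist p) :=
  point_structure hp (fun _ => 0%N) code.
Definition uninformed (p : K -> R) (hp : is_dist p) :=
  point_structure hp (fun _ => 0%N) (fun _ => 0%N).

(** Both players try to name the state.  The weight [alpha k] fixes how the prize
    is shared when both succeed; an optimal dual weight makes the game decisive. *)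
Definition guessing_game (alpha : K -> R) (k i j : K) : R :=
  if i == k then (if j == k then 1 - 2 * alpha k else 1)
  else (if j == k then -1 else 0).

Lemma guessing_gameP alpha : (forall k, 0 <= alpha k <= 1) ->
  is_payoff (guessing_game alpha).
Proof.
move=> h k i j; have := h k; rewrite /guessing_game.
by case: ifP => _; case: ifP => _; lra.
Qed.

Variables (p q : K -> R) (hp : is_dist p) (hq : is_dist q).

(** The informed player names the state.  In [informed1 hp] an uninformed guess
    [k] by player 2 only costs 2 alpha_k p_k <= 2 a; in [informed2 hq] an
    uninformed guess [k] by player 1 only gains 2 (1 - alpha_k) q_k <= 2 b. *)
Lemma guessing_game_distance (a b : R) (alpha : K -> R) : (0 < #|K|)%N ->
  (forall k, 0 <= alpha k <= 1) -> (forall k, alpha k * p k <= a) ->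
  (forall k, (1 - alpha k) * q k <= b) ->
  2 * (1 - (a + b)) <= value_distance (informed1 hp) (informed2 hq).
Proof.
move=> K0 halpha ha hb; have [k0 _] := card_gt0P K0.
have hg := guessing_gameP halpha.
apply: (value_distance_ge K0 K0 hg).
have lo : 1 - 2 * a <= val_game (informed1 hp) (guessing_game alpha).
  apply: (val_game_ge K0 K0 hg (reveal_strategy k0)) => t /(_ 0%N)[t0 t1].
  rewrite expected_payoff_point_structure.
  have -> : \sum_k p k * stage_payoff (guessing_game alpha) k
        (reveal k0 (code k)) (t 0%N) =
      1 - 2 * \sum_k t 0%N k * (alpha k * p k).
    rewrite -[X in X - 2 * _](proj2 hp) mulr_sumr -sumrB; apply: eq_bigr => k _.
    rewrite reveal_code stage_payoffEr.
    under eq_bigr do rewrite sum_dirac_at /guessing_game eqxx.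
    rewrite (eq_bigr (fun j => t 0%N j - dirac_at R k j * (2 * alpha k * t 0%N j))).
      rewrite sumrB t1 sum_dirac_at; ring.
    by move=> j _; rewrite /dirac_at; case: eqP => [->|_]; rewrite /=; ring.
  rewrite lerD2l lerN2 ler_pM2l // -[leRHS]mul1r -t1 mulr_suml.
  by apply: ler_sum => k _; exact: ler_wpM2l.
have hi : val_game (informed2 hq) (guessing_game alpha) <= -1 + 2 * b.
  apply: (val_game_le K0 K0 hg (reveal_strategy k0)) => s /(_ 0%N)[s0 s1].
  rewrite expected_payoff_point_structure.
  have -> : \sum_k q k * stage_payoff (guessing_game alpha) k (s 0%N)
        (reveal k0 (code k)) =
      -1 + 2 * \sum_k s 0%N k * ((1 - alpha k) * q k).
    rewrite -[X in - X + _](proj2 hq) mulr_sumr -sumrN -big_split; apply: eq_bigr => k _ /=.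
    rewrite reveal_code stage_payoffEl.
    under eq_bigr do rewrite sum_dirac_at /guessing_game eqxx.
    rewrite (eq_bigr (fun i => dirac_at R k i * (2 * (1 - alpha k) * s 0%N i) - s 0%N i)).
      rewrite sumrB s1 sum_dirac_at; ring.
    by move=> i _; rewrite /dirac_at; case: eqP => [->|_]; rewrite /=; ring.
  rewrite lerD2l ler_pM2l // -[leRHS]mul1r -[X in _ <= X * _]s1 mulr_suml.
  by apply: ler_sum => k _; exact: ler_wpM2l.
move: (val_game _ _) (val_game _ _) lo hi => x y; lra.
Qed.

Lemma overlapsC : overlaps p q = overlaps q p.
Proof.
by apply/seteqP; split=> r [p' [q' [hp' hq' ->]]]; exists q', p'; split=> //;
  apply: eq_bigr => k _; rewrite minC; congr Num.min; exact: mulrC.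
Qed.

Lemma value_distance_le_overlap (u v : info_structure R K) M :
  margK u =1 p -> margK v =1 q -> overlaps p q M ->
  value_distance u v <= 2 * (1 - M).
Proof.
move=> up vq oM; apply: value_distance_le => I J g hI hJ hg; split.
  by have [p' [q' [hp' hq' ->]]] := oM; exact: val_game_le_overlap.
have [q' [p' [hq' hp' ->]]] : overlaps q p M by rewrite -overlapsC.
exact: val_game_le_overlap.
Qed.

Lemma is_max_distances (a b : R) (alpha : K -> R) : (0 < #|K|)%N ->
  (forall k, 0 <= alpha k <= 1) -> (forall k, alpha k * p k <= a) ->
  (forall k, (1 - alpha k) * q k <= b) -> overlaps p q (a + b) ->
  is_max (distances p q) (2 * (1 - (a + b))).
Proof.
move=> K0 halpha ha hb oM; split.
  exists (informed1 hp), (informed2 hq).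
  have up := margK_point_structure hp code (fun _ => 0%N).
  have vq := margK_point_structure hq (fun _ => 0%N) code.
  split=> //; apply/eqP; rewrite eq_le (guessing_game_distance _ halpha) //=.
  exact: value_distance_le_overlap.
by move=> _ [u [v [up vq ->]]]; exact: value_distance_le_overlap.
Qed.

Lemma stage_payoff_const (I J : finType) (f : K -> R) k x y :
  is_dist x -> is_dist y ->
  stage_payoff (fun k (_ : I) (_ : J) => f k) k x y = f k.
Proof.
move=> [_ x1] [_ y1]; rewrite stage_payoffEl -mulr_sumr x1 mulr1.
by rewrite -mulr_suml y1 mul1r.
Qed.

(** With a single action for each player, the game pays the sign of [p k - q k]
    and no strategy has any influence. *)
Lemma value_distance_ge_marg (u v : info_structure R K) :
  margK u =1 p -> margK v =1 q ->
  \sum_k `|p k - q k| <= value_distance u v.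
Proof.
move=> up vq; pose g k (_ _ : unit) : R := Num.sg (p k - q k).
have hg : is_payoff g by move=> k i j; rewrite -ler_norml normr_sg lern1; case: eqP.
have h1 : (0 < #|{: unit}|)%N by rewrite card_unit.
have [s hs] := strategy_nonempty R h1.
have payE w t t' : strategy t -> strategy t' ->
    expected_payoff w g t t' = \sum_k margK w k * Num.sg (p k - q k).
  move=> ht ht'; have [sigma [hsigma E]] := uninformative_payoffr g h1 w ht.
  have -> : t' = fun _ => t' 0%N.
    apply/funext => c; apply/funext => -[].
    have /esym := proj2 (ht' c); have /esym := proj2 (ht' 0%N).
    by rewrite !(big_pred1 tt) => [<- <-||] // -[].
  by rewrite E; apply: eq_bigr => k _; rewrite stage_payoff_const.
have valE w : val_game w g = \sum_k margK w k * Num.sg (p k - q k).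
  apply/eqP; rewrite eq_le; apply/andP; split.
    by apply: (val_game_le h1 h1 hg hs) => t ht; rewrite payE.
  by apply: (val_game_ge h1 h1 hg hs) => t ht; rewrite payE.
apply: (value_distance_ge h1 h1 hg); rewrite !valE -sumrB.
by apply: ler_sum => k _; rewrite up vq -mulrBl mulrC -normrEsg.
Qed.

(** Without information the strategies of both games coincide, and each pair of
    them earns payoffs that differ only through the weights of the states. *)
Lemma value_distance_uninformed_le :
  value_distance (uninformed hp) (uninformed hq) <= \sum_k `|p k - q k|.
Proof.
apply: value_distance_le => I J g hI hJ hg.
have close s t : strategy s -> strategy t ->
    `|expected_payoff (uninformed hp) g s t - expected_payoff (uninformed hq) g s t|
    <= \sum_k `|p k - q k|.
  move=> hs ht; rewrite !expected_payoff_point_structure -sumrB.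
  apply: le_trans (ler_norm_sum _ _ _) _; apply: ler_sum => k _.
  rewrite -mulrBl normrM -[leRHS]mulr1 ler_wpM2l //.
  exact: stage_payoff_norm.
split; apply: val_game_le_of_replies => // s t hs ht; exists s, t; split=> //;
  by have := close s t hs ht; rewrite ler_distlD => /andP[].
Qed.

End ExtremeStructures.

Lemma is_max_unique (R : realType) (A : set R) m m' :
  is_max A m -> is_max A m' -> m = m'.
Proof.
by move=> [Am um] [Am' um']; apply/eqP; rewrite eq_le um // um'.
Qed.

Lemma is_max_overlaps_diag (R : realType) (K : finType) (p : K -> R) :
  (0 < #|K|)%N -> is_dist p -> is_max (overlaps p p) (\big[Num.max/0]_k p k).
Proof.
move=> /card_gt0P[k0 _] [p0 p1].
have [k1 _ k1max] := @arg_maxP _ _ _ k0 predT p isT.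
have -> : \big[Num.max/0]_k p k = p k1.
  apply/eqP; rewrite eq_le le_bigmax andbT; apply/bigmax_leP.
  by split=> // k _; exact: k1max.
split.
  exists (dirac_at R k1), (dirac_at R k1); split; [exact: dirac_at_dist|exact: dirac_at_dist|].
  under eq_bigr do rewrite [p _ * _]mulrC minxx.
  by rewrite sum_dirac_at.
move=> _ [p' [q' [hp' [q0 q1] ->]]].
apply: (@le_trans _ _ (\sum_k p k1 * q' k)); last by rewrite -mulr_sumr q1 mulr1.
apply: ler_sum => k _; apply: (@le_trans _ _ (p k * q' k)).
  by rewrite ge_min lexx.
by rewrite ler_wpM2r //; exact: k1max.
Qed.

Theorem proposition4 (R : realType) (K : finType) (hK : (1 < #|K|)%N)
    (p q : K -> R) (hp : is_dist p) (hq : is_dist q) :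
  [/\ is_min (distances p q) (\sum_k `|p k - q k|),
      exists M : R, is_max (overlaps p q) M /\
                    is_max (distances p q) (2 * (1 - M))
    & p = q ->
      is_max (distances p q) (2 * (1 - \big[Num.max/0]_k p k))].
Proof.
have K0 : (0 < #|K|)%N := ltnW hK.
have [a [b [alpha [halpha ha hb maxM]]]] := overlap_duality p q K0.
have maxD := is_max_distances hp hq K0 halpha ha hb (proj1 maxM).
split.
- split.
    exists (uninformed hp), (uninformed hq).
    have up := margK_point_structure hp (fun _ => 0%N) (fun _ => 0%N).
    have vq := margK_point_structure hq (fun _ => 0%N) (fun _ => 0%N).
    split=> //; apply/eqP.
    by rewrite eq_le value_distance_ge_marg // value_distance_uninformed_le.
  by move=> _ [u [v [up vq ->]]]; exact: value_distance_ge_marg.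
- by exists (a + b).
- move=> pq; subst q.
  by rewrite (is_max_unique (is_max_overlaps_diag K0 hp) maxM).
Qed.
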